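(* For every $\varepsilon>0$ and every sufficiently large integer $n$ the following holds. Suppose that (i) $0<p:=p(n)\le 1$, and (ii) $a_1,\ldots,a_n$ are integers such that $a_i\ge \frac{(1+\varepsilon)\ln n}{p}$ for every $1\le i\le n$. Then BoxBreaker has a polynomial-time strategy for the $p$-random-turn game $Box_p(a_1,\ldots,a_n)$ that w.h.p. leads him to win the game.
   Context: The $p$-random-turn game $Box_p(a_1,\ldots,a_n)$: the board is the disjoint union of $n$ sets (boxes) $F_1,\ldots,F_n$ with $|F_i|=a_i$. Two players, BoxMaker and BoxBreaker, claim previously unclaimed board elements. Before each turn a biased coin is tossed, independently of all other turns: with probability $p$ BoxBreaker plays this turn, and with probability $1-p$ BoxMaker plays it; the chosen player claims exactly one unclaimed element. The game lasts until all elements are claimed. BoxMaker wins if he claims all elements of some box; otherwise (i.e. if BoxBreaker claims at least one element of every box) BoxBreaker wins. A strategy of a player prescribes (possibly using randomization) his next move on the basis of the history of the game so far; it is polynomial-time if each move can be computed in time polynomial in the size of the board. ''W.h.p.'' means with probability tending to $1$ as $n\to\infty$ (over the coin tosses and any randomness of the strategy), against any strategy of the opponent. *)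

(* Defs.v *)
From HB Require Import structures.
From mathcomp Require Import all_boot all_order all_algebra.
From mathcomp Require Import all_classical all_reals all_analysis.

Set Implicit Arguments.
Unset Strict Implicit.
Unset Printing Implicit Defensive.

Import Order.TTheory GRing.Theory Num.Theory.

Local Open Scope ring_scope.

Section Game.
Variables (n : nat) (a : 'I_n -> nat).

(* The disjoint union of the boxes: [tag x] is the box containing [x]. *)
Definition board : finType := {i : 'I_n & 'I_(a i)}.

(* The player who moved ([true] = BoxBreaker, [false] = BoxMaker) and the
   element claimed. *)
Definition move : finType := (bool * board)%type.

Definition history := seq move.

Definition unclaimed (h : history) (x : board) : bool :=
  x \notin [seq m.2 | m <- h].

(* A history of a game in which some element is still unclaimed. *)
Definition position (h : history) : bool :=
  uniq [seq m.2 | m <- h] && (size h < #|board|)%N.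

Definition maker_wins (h : history) : bool :=
  [exists i : 'I_n, forall y : 'I_(a i),
     (false, Tagged (fun j => 'I_(a j)) y) \in h].

Definition breaker_wins (h : history) : bool := ~~ maker_wins h.

Variable R : realType.

(* A randomized strategy: [s h x] is the probability of claiming [x] when the
   history is [h] and it is the player's turn. *)
Definition strategy := history -> board -> R.

(* Values of [s] outside of [position] are irrelevant. *)
Definition is_strategy (s : strategy) : Prop :=
  forall h, position h ->
    [/\ forall x, 0 <= s h x,
        \sum_x s h x = 1
      & forall x, ~~ unclaimed h x -> s h x = 0].

Definition turn_prob (p : R) (breaker maker : strategy) (h : history)
    (m : move) : R :=
  if m.1 then p * breaker h m.2 else (1 - p) * maker h m.2.

(* The game lasts exactly [#|board|] turns.  A tuple in which some element is
   repeated gets probability 0 as soon as both arguments satisfy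
   [is_strategy]. *)
Definition play_prob (p : R) (breaker maker : strategy)
    (w : #|board|.-tuple move) : R :=
  \prod_(t < #|board|) turn_prob p breaker maker (take t w) (tnth w t).

Definition breaker_win_prob (p : R) (breaker maker : strategy) : R :=
  \sum_(w : #|board|.-tuple move | breaker_wins w)
     play_prob p breaker maker w.

End Game.

(* A random access machine with structured control, coin tosses and unit cost
   per command.  Addition is the only operation that can increase numbers, and
   a program is a fixed finite object, so that a number computed in [t] steps
   has O(t) more bits than the numbers of the input.  Hence polynomial time is
   the same as for probabilistic Turing machines. *)
Inductive expr :=
| ECst of nat
| EReg of nat
| ECell of expr
| EAdd of expr & expr
| ESub of expr & expr.

Inductive cmd :=
| Assign of nat & expr
| Store of expr & expr
| Flip of nat
| Seq of cmd & cmd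
| If of expr & cmd & cmd
| While of expr & cmd.

Record state := State {
  regs : nat -> nat;
  mem : nat -> nat;
  coins : seq bool
}.

Fixpoint eval (s : state) (e : expr) : nat :=
  match e with
  | ECst k => k
  | EReg x => regs s x
  | ECell e1 => mem s (eval s e1)
  | EAdd e1 e2 => (eval s e1 + eval s e2)%N
  | ESub e1 e2 => (eval s e1 - eval s e2)%N
  end.

Definition set_reg (s : state) (x v : nat) : state :=
  State [eta regs s with x |-> v] (mem s) (coins s).

Definition set_mem (s : state) (x v : nat) : state :=
  State (regs s) [eta mem s with x |-> v] (coins s).

Definition flip (s : state) (x : nat) : state :=
  State [eta regs s with x |-> nat_of_bool (head false (coins s))]
        (mem s) (behead (coins s)).

(* The commands still to be executed, and the current state. *)
Definition config := (seq cmd * state)%type.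

Definition step (cf : config) : config :=
  let: (k, s) := cf in
  if k is c :: k' then
    match c with
    | Assign x e => (k', set_reg s x (eval s e))
    | Store e1 e2 => (k', set_mem s (eval s e1) (eval s e2))
    | Flip x => (k', flip s x)
    | Seq c1 c2 => (c1 :: c2 :: k', s)
    | If e c1 c2 => ((if eval s e != 0%N then c1 else c2) :: k', s)
    | While e c1 => ((if eval s e != 0%N then c1 :: k else k'), s)
    end
  else cf.

Definition halted (cf : config) : bool := nilp cf.1.

Section PolynomialTime.
Variables (n : nat) (a : 'I_n -> nat).

Definition encode_move (m : move a) : seq nat :=
  [:: nat_of_bool m.1; nat_of_ord (tag m.2); nat_of_ord (tagged m.2)].

Definition encode (h : history a) : seq nat :=
  n :: [seq a i | i <- enum 'I_n]
    ++ size h :: flatten [seq encode_move m | m <- h].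

Definition start (c : cmd) (h : history a) (r : seq bool) : config :=
  ([:: c], State (fun=> 0%N) (nth 0%N (encode h)) r).

Definition run (c : cmd) (h : history a) (T : nat) (r : seq bool) : config :=
  iter T step (start c h r).

(* The move is read off registers 0 (index of the box) and 1 (index of the
   element in the box). *)
Definition outputs (cf : config) (x : board a) : bool :=
  (regs cf.2 0 == tag x :> nat) && (regs cf.2 1 == tagged x :> nat).

End PolynomialTime.

(* One program for all boards.  It is run for [T] steps, [T] polynomial in the
   size of the board, with [T] fair coins: these suffice for [T] steps.  Boards
   with empty boxes are excluded because there the number of boxes, hence the
   length of the input, is not bounded in terms of the size of the board. *)
Definition polynomial_time (R : realType)
    (s : forall (n : nat) (a : 'I_n -> nat), strategy a R) : Prop :=
  exists (c : cmd) (C d : nat),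
    forall (n : nat) (a : 'I_n -> nat), (forall i, 0 < a i)%N ->
    forall h : history a, position h ->
      let T := (C * #|board a| ^ d)%N in
      (forall r : T.-tuple bool, halted (run c h T r)) /\
      (forall x : board a,
         s n a h x
         = #|[set r : T.-tuple bool | outputs (run c h T r) x]|%:R / 2 ^+ T).

(* Main.v *)
(* Breaker plays greedily: he claims an element of a box in which he has no
   element yet and which has the fewest free elements.  Give such a box with f
   free elements the weight (1 - p)^f, and all other boxes the weight 0.  If
   Maker claims an element of a box of weight w, the total weight, multiplied by
   the probability 1 - p of his turn, grows by p w.  Breaker's turn has
   probability p and destroys the maximal weight.  So the total weight is a
   supermartingale; it starts below n^(-eps) and is at least 1 when Maker wins.
   The strategy does not depend on p or eps. *)
Require Import Defs.
From HB Require Import structures.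
From mathcomp Require Import all_boot all_order all_algebra.
From mathcomp Require Import all_classical all_reals all_analysis.
From mathcomp Require Import zify ring lra.

Set Implicit Arguments.
Unset Strict Implicit.
Unset Printing Implicit Defensive.

Import Order.TTheory GRing.Theory Num.Theory.

Local Open Scope classical_set_scope.
Local Open Scope ring_scope.

(** * Counting loops on the random access machine *)

Section Machine.
Local Open Scope nat_scope.
Variable M : nat -> nat.

(** Expressions never read the coins, so the empty coin sequence is a dummy. *)
Definition value (rg : nat -> nat) (e : expr) : nat :=
  Defs.eval (State rg M [::]) e.

Lemma eval_value rg r e : Defs.eval (State rg M r) e = value rg e.
Proof.
by rewrite /value; elim: e => //= [e ->|e1 -> e2 ->|e1 -> e2 ->].
Qed.

(* Only meaningful for programs without [Store] and [Flip] all of whose loops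
   are counting loops: there the guard is the number of iterations. *)
Fixpoint sem (c : cmd) (rg : nat -> nat) : nat -> nat :=
  match c with
  | Assign x e => [eta rg with x |-> value rg e]
  | Seq c1 c2 => sem c2 (sem c1 rg)
  | If e c1 c2 => if value rg e != 0 then sem c1 rg else sem c2 rg
  | While e c1 => iter (value rg e) (sem c1) rg
  | Store _ _ | Flip _ => rg
  end.

Lemma sem_while x c rg :
  sem (While (EReg x) c) rg = iter (rg x) (sem c) rg.
Proof. by []. Qed.

Fixpoint writes (c : cmd) : seq nat :=
  match c with
  | Assign x _ => [:: x]
  | Seq c1 c2 | If _ c1 c2 => writes c1 ++ writes c2
  | While _ c1 => writes c1
  | Store _ _ | Flip _ => [::]
  end.

Lemma sem_frame x c rg : x \notin writes c -> sem c rg x = rg x.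
Proof.
elim: c rg => //= [y e|c1 IH1 c2 IH2|e c1 IH1 c2 IH2|e c IH] rg.
- by rewrite inE => /negPf ->.
- by rewrite mem_cat => /norP[x1 x2]; rewrite IH2 ?IH1.
- by rewrite mem_cat => /norP[x1 x2]; case: ifP; rewrite ?IH2 ?IH1.
- by move=> xc; elim: (value rg e) => //= k <-; apply: IH.
Qed.

(** The counter is decremented before the body, which thus sees the indices in decreasing order,
    ending with 0. *)
Definition for_ (x : nat) (e : expr) (c : cmd) : cmd :=
  Seq (Assign x e)
    (While (EReg x) (Seq (Assign x (ESub (EReg x) (ECst 1))) c)).

(** Invariant rule for a descending loop: [P k] describes the registers once exactly the indices
    from [k] on have been processed. *)
Lemma for_ind x e c rg (P : nat -> (nat -> nat) -> Prop) :
    x \notin writes c ->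
    P (value rg e) [eta rg with x |-> value rg e] ->
    (forall k rg', k < value rg e -> P k.+1 rg' ->
       P k (sem c [eta rg' with x |-> k])) ->
  P 0 (sem (for_ x e c) rg).
Proof.
move=> xc; set N := value rg e; set rg0 := [eta rg with x |-> N] => P0 PS.
pose f := sem (Seq (Assign x (ESub (EReg x) (ECst 1))) c).
have -> : sem (for_ x e c) rg = iter N f rg0.
  by rewrite /= -/N {1}/value /= eqxx.
suff H k : k <= N -> iter k f rg0 x = N - k /\ P (N - k) (iter k f rg0).
  by have [_] := H N (leqnn _); rewrite subnn.
elim: k => [|k IH] kN; first by rewrite subn0 /= eqxx.
have [/= xk Pk] := IH (ltnW kN).
rewrite {1 3}/f /= sem_frame //= eqxx /value /= xk subn1 -subnS.
by split=> //; apply: PS; rewrite ?subnSK //; lia.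
Qed.

(** The pending commands [k] are arbitrary so that programs compose, and [B] is uniform in the
    registers. *)
Definition runs (c : cmd) (B : nat) : Prop :=
  forall rg r k, exists2 t, t <= B &
    iter t step (c :: k, State rg M r) = (k, State (sem c rg) M r).

Fixpoint cost (N : nat) (c : cmd) : nat :=
  match c with
  | Assign _ _ | Store _ _ | Flip _ => 1
  | Seq c1 c2 | If _ c1 c2 => (cost N c1 + cost N c2).+1
  | While _ c1 => (N * (cost N c1).+1).+1
  end.

Variable N : nat.

Lemma runs_assign x e : runs (Assign x e) (cost N (Assign x e)).
Proof. by move=> rg r k; exists 1 => //=; rewrite eval_value. Qed.

Lemma runs_seq c1 c2 : runs c1 (cost N c1) -> runs c2 (cost N c2) ->
  runs (Seq c1 c2) (cost N (Seq c1 c2)).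
Proof.
move=> r1 r2 rg r k.
have [t1 le1 E1] := r1 rg r (c2 :: k); have [t2 le2 E2] := r2 (sem c1 rg) r k.
exists (t2 + t1).+1; first by rewrite ltnS addnC leq_add.
by rewrite iterSr /= iterD E1.
Qed.

Lemma runs_if e c1 c2 : runs c1 (cost N c1) -> runs c2 (cost N c2) ->
  runs (If e c1 c2) (cost N (If e c1 c2)).
Proof.
move=> r1 r2 rg r k /=; case: ifP => He.
  have [t le E] := r1 rg r k; exists t.+1; first by lia.
  by rewrite iterSr /= eval_value He.
have [t le E] := r2 rg r k; exists t.+1; first by lia.
by rewrite iterSr /= eval_value He.
Qed.

(** A loop bound read from memory is at most [N] whatever the registers contain; this is why [e] has
    to be a cell. *)
Lemma runs_for x e c : (forall i, M i <= N) -> x \notin writes c ->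
    (exists e', e = ECell e') -> runs c (cost N c) ->
  runs (for_ x e c) (cost N (for_ x e c)).
Proof.
move=> MN xc [e' ->{e}] rc rg r k.
set body := Seq (Assign x (ESub (EReg x) (ECst 1))) c.
have rbody : runs body (cost N body).
  exact: runs_seq (runs_assign _ _) rc.
set v := value rg (ECell e'); have vN : v <= N by exact: MN.
have loop w rg' : rg' x = w -> exists2 t, t <= (w * (cost N body).+1).+1 &
    iter t step (While (EReg x) body :: k, State rg' M r)
    = (k, State (sem (While (EReg x) body) rg') M r).
  elim: w rg' => [|w IH] rg' xw; first by exists 1 => //=; rewrite /value /= xw.
  have [t1 le1 E1] := rbody rg' r (While (EReg x) body :: k).
  have xw' : sem body rg' x = w.
    by rewrite /= sem_frame //= eqxx /value /= xw subn1.
  have [t2 le2 E2] := IH _ xw'.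
  exists (t2 + t1).+1; first by lia.
  rewrite iterSr [step _]/= xw [_ != 0]/= iterD E1 E2.
  by rewrite !sem_while xw xw' iterSr.
have [t le E] := loop v [eta rg with x |-> v] ltac:(by rewrite /= eqxx).
have Ev : M (Defs.eval (State rg M r) e') = v by rewrite eval_value.
(* One extra step unfolds [Seq], the other assigns the counter. *)
exists t.+2; last by rewrite !iterSr /= Ev E.
apply: leq_trans (_ : (v * (cost N body).+1).+3 <= _); first by [].
by rewrite [leqRHS]/= add1n !ltnS leq_mul2r vN orbT.
Qed.

End Machine.

(** * The greedy program *)

Local Notation rI := 2%N.
Local Notation rJ := 3%N.
Local Notation rT := 4%N.
Local Notation rClaimed := 5%N.
Local Notation rFree := 6%N.
Local Notation rTouched := 7%N.
Local Notation rBest := 8%N.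
Local Notation rJunk := 9%N.

Section Program.
Local Open Scope nat_scope.

Definition nop : cmd := Assign rJunk (ECst 0).

(** Subtraction is truncated, so the sum vanishes exactly when both values agree. *)
Definition neq (e1 e2 : expr) : expr := EAdd (ESub e1 e2) (ESub e2 e1).

(** Memory layout for [n] boxes: cell 0 holds [n], cells 1 to [n] the box sizes, cell [n + 1] the
    number of moves; from cell [n + 2] on there are three cells per move. *)
Definition boxes : expr := ECell (ECst 0).
Definition box_size : expr := ECell (EAdd (ECst 1) (EReg rI)).
Definition moves : expr := ECell (EAdd (ECst 1) boxes).

(* Component [k - 2] of the encoding of move number [rT]. *)
Definition move_cell (k : nat) : expr :=
  ECell (EAdd (EAdd boxes (ECst k))
              (EAdd (EReg rT) (EAdd (EReg rT) (EReg rT)))).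

(** The player's bit is added to [rTouched], which thus counts Breaker's moves in box [rI]. *)
Definition scan_move : cmd :=
  If (neq (move_cell 3) (EReg rI)) nop
    (Seq (Assign rFree (ESub (EReg rFree) (ECst 1)))
    (Seq (Assign rTouched (EAdd (EReg rTouched) (move_cell 2)))
         (If (neq (move_cell 4) (EReg rJ)) nop
            (Assign rClaimed (EAdd (EReg rClaimed) (ECst 1)))))).

Definition scan : cmd :=
  Seq (Assign rClaimed (ECst 0))
  (Seq (Assign rFree box_size)
  (Seq (Assign rTouched (ECst 0))
       (for_ rT moves scan_move))).

Definition choose_element : cmd :=
  Seq (Assign 0 (EReg rI)) (Assign 1 (EReg rJ)).

Definition choose_box : cmd :=
  Seq (Assign rBest (EAdd (EReg rFree) (ECst 1))) choose_element.

(* [rBest] is 0 as long as no unclaimed element of an untouched box was seen,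
   and otherwise one more than the number of free elements of the best box. *)
Definition update : cmd :=
  If (EReg rClaimed) nop
    (If (EReg rTouched)
       (If (EReg rBest) nop choose_element)
       (If (EReg rBest)
          (If (ESub (EReg rBest) (EAdd (EReg rFree) (ECst 1))) choose_box nop)
          choose_box)).

Definition greedy : cmd :=
  for_ rI boxes (for_ rJ box_size (Seq scan update)).

(** The cube comes from three nested loops: over boxes, elements and moves. *)
Lemma cost_greedy N : 0 < N -> cost N greedy <= 100 * N ^ 3.
Proof.
move=> N0 /=.
have N1 : N <= N ^ 2 by rewrite -{1}(expn1 N) leq_pexp2l.
have N2 : N ^ 2 <= N ^ 3 by rewrite leq_pexp2l.
move: N1 N2; rewrite !expnS expn0 muln1; nia.
Qed.

Lemma runs_greedy M N : (forall i, M i <= N) -> runs M greedy (cost N greedy).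
Proof.
move=> MN.
have ra x e : runs M (Assign x e) (cost N (Assign x e)) by exact: runs_assign.
do ![exact: ra | by eexists | apply: runs_for => // | apply: runs_seq
    | apply: runs_if].
Qed.

End Program.

(** * The memory image of a history *)

Section Encoding.
Local Open Scope nat_scope.
Variables (n : nat) (a : 'I_n -> nat) (h : history a).

Local Notation M := (nth 0 (encode h)).

Lemma encode_box_size (i : 'I_n) : M i.+1 = a i.
Proof.
rewrite /encode /= nth_cat size_map size_enum_ord ltn_ord.
by rewrite (nth_map i) ?size_enum_ord // nth_ord_enum.
Qed.

Lemma encode_moves : M n.+1 = size h.
Proof. by rewrite /encode /= nth_cat size_map size_enum_ord ltnn subnn. Qed.

Lemma encode_move_cell x0 t k : t < size h -> k < 3 ->
  M (n + k.+2 + (t + (t + t))) = nth 0 (encode_move (nth x0 h t)) k.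
Proof.
move=> th k3.
have -> : n + k.+2 + (t + (t + t)) = (n + (t * 3 + k).+1).+1 by lia.
rewrite /encode /= nth_cat size_map size_enum_ord ltnNge leq_addr addKn /=.
elim: h t th => [|m s IH] [|t] //= th; first by case: k k3 {IH} => [|[|[]]].
exact: IH.
Qed.

Lemma card_board : #|board a| = \sum_i a i.
Proof.
rewrite card_tagged sumnE big_map big_enum.
by apply: eq_bigr => i _; rewrite card_ord.
Qed.

Lemma leq_box_board i : a i <= #|board a|.
Proof. by rewrite card_board (bigD1 i) //= leq_addr. Qed.

(** The loop bounds are memory cells, so this controls the running time. Nonempty boxes make [n] at
    most the size of the board. *)
Lemma encode_le : (forall i, 0 < a i) -> position h ->
  forall k, M k <= #|board a|.
Proof.
move=> a0 /andP[_ /ltnW hN] k.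
have nN : n <= #|board a|.
  rewrite card_board -{1}(card_ord n) -sum1_card.
  by apply: leq_sum => i _; apply: a0.
have [ks|] := ltnP k (size (encode h)); last by move=> ?; rewrite nth_default.
suff /allP : all (leq^~ #|board a|) (encode h) by apply; apply: mem_nth.
rewrite /= nN all_cat all_map /= hN; apply/and3P; split=> //.
  by apply/allP => i _ /=; apply: leq_box_board.
apply/allP => v /flatten_mapP[m _] vm.
suff /allP/(_ v vm) : all (leq^~ #|board a|) (encode_move m) by [].
rewrite /= (leq_trans (ltnW (ltn_ord (tag m.2))) nN).
rewrite (leq_trans (ltnW (ltn_ord (tagged m.2))) (leq_box_board _)).
by rewrite (leq_trans (leq_b1 _)) // (leq_trans _ (leq_box_board (tag m.2))).
Qed.

End Encoding.

(** * Correctness of the greedy program *)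

Section Greedy.
Local Open Scope nat_scope.
Variables (n : nat) (a : 'I_n -> nat).
Implicit Types (x y : board a) (h : history a).

Definition in_box (i : 'I_n) (m : move a) : bool := tag m.2 == i.

Definition touched h (i : 'I_n) : bool := has (fun m => m.1 && in_box i m) h.

Definition free h (i : 'I_n) : nat := a i - count (in_box i) h.

Definition located x (rg : nat -> nat) (r1 r2 : nat) : Prop :=
  rg r1 = tag x /\ rg r2 = tagged x.

Lemma eq_board x y :
  (x == y) = (tag x == tag y) && (tagged x == tagged y :> nat).
Proof.
apply/eqP/andP => [->//|[]]; case: x y => [i u] [j v] /= /eqP ij.
by case: _ / ij v => v /eqP/val_inj->.
Qed.

Lemma exists_unclaimed h : position h -> exists x, unclaimed h x.
Proof.
case/andP=> _; case: (pickP (unclaimed h)) => [x|all_claimed].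
  by exists x.
rewrite ltnNge -(size_map snd h) (leq_trans _ (card_size _)) //.
by apply/subset_leq_card/fintype.subsetP => x _; move/negbFE: (all_claimed x).
Qed.

Lemma value_neq M rg e1 e2 :
  (value M rg (neq e1 e2) != 0) = (value M rg e1 != value M rg e2).
Proof. by rewrite /value /=; lia. Qed.

Lemma sem_seq M c1 c2 rg : sem M (Seq c1 c2) rg = sem M c2 (sem M c1 rg).
Proof. by []. Qed.

Lemma value_reg M rg r : value M rg (EReg r) = rg r.
Proof. by []. Qed.

Lemma sem_if M e c1 c2 rg :
  sem M (If e c1 c2) rg = sem M (if value M rg e != 0 then c1 else c2) rg.
Proof. by rewrite /=; case: ifP. Qed.

Section Run.
(* A variable [M] prevents simplification from unfolding the encoding. *)
Variables (h : history a) (M : nat -> nat).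
Hypothesis defM : M = nth 0 (encode h).

Let M_boxes : M 0 = n. Proof. by rewrite defM. Qed.

Let M_box_size (i : 'I_n) : M i.+1 = a i.
Proof. by rewrite defM encode_box_size. Qed.

Let M_moves : M n.+1 = size h. Proof. by rewrite defM encode_moves. Qed.

Lemma value_moves rg : value M rg moves = size h.
Proof. by rewrite /value /= M_boxes M_moves. Qed.

Lemma value_move_cell m0 rg k : rg rT < size h -> k < 3 ->
  value M rg (move_cell k.+2) = nth 0 (encode_move (nth m0 h (rg rT))) k.
Proof. by move=> th k3; rewrite -encode_move_cell // -defM -{1}M_boxes. Qed.

Lemma scanP x rg : located x rg rI rJ ->
  [/\ (sem M scan rg rClaimed == 0) = unclaimed h x,
      sem M scan rg rFree = free h (tag x)
    & (sem M scan rg rTouched != 0) = touched h (tag x)].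
Proof.
move=> [rgI rgJ].
(* The history is scanned from its last move backwards, so the moves already seen are those of
   [drop k h]. *)
pose P k rg := [/\ located x rg rI rJ,
  rg rClaimed = count (fun m => m.2 == x) (drop k h),
  rg rFree = a (tag x) - count (in_box (tag x)) (drop k h)
  & rg rTouched = count (fun m => m.1 && in_box (tag x) m) (drop k h)].
have : P 0 (sem M scan rg).
  rewrite /scan 3!sem_seq; apply: for_ind => //.
    rewrite value_moves /P /located drop_size /= /value /=.
    by rewrite rgI rgJ M_box_size subn0.
  move=> k rg1; rewrite value_moves => kh [[rgI1 rgJ1] E5 E6 E7].
  have m0 : move a by case: (h) kh.
  set rg2 := [eta rg1 with _ |-> _].
  have [rgI2 rgJ2] : located x rg2 rI rJ by [].
  have E := value_move_cell m0 (rg := rg2) kh.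
  rewrite /P /located (drop_nth m0 kh); move: (nth m0 h k) E => m E.
  rewrite /scan_move sem_if value_neq E // value_reg rgI2 [nth _ _ _]/=.
  rewrite ![count _ (_ :: _)]/= -E5 /in_box eq_board -!(inj_eq val_inj).
  case: eqVneq => xm /=; last by rewrite /= andbF.
  rewrite value_neq -[value _ _ (move_cell 4)]/(value M rg2 (move_cell 4)) E //.
  rewrite -[value _ _ (EReg rJ)]/(rg2 rJ) rgJ2.
  rewrite -[value _ _ (EAdd (EReg rTouched) _)]
           /(rg1 rTouched + value M rg2 (move_cell 2)).
  rewrite E // -[value _ rg2 (ESub _ _)]/(rg1 rFree - 1).
  have F : rg1 rFree - 1 =
      a (tag x) - (1 + count (in_box (tag x)) (drop k.+1 h)).
    by rewrite E6 subnAC -subnDA.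
  have G : rg1 rTouched + m.1 = m.1 && true +
      count (fun m => m.1 && in_box (tag x) m) (drop k.+1 h).
    by rewrite E7 andbT addnC.
  by case: eqVneq => xm' /=; split=> //; rewrite /value /= addnC.
rewrite /P drop0 => -[_ -> -> ->]; split=> //.
  by rewrite eqn0Ngt -has_count /unclaimed -has_pred1 has_map.
by rewrite -lt0n -has_count.
Qed.

(** Loop invariant, with [Q] the elements inspected so far. A choice in a touched box is a fallback:
    it leaves [rBest] at 0, and the last clause then says that [Q] has no unclaimed element in an
    untouched box. *)
Definition best_among (Q : pred (board a)) (rg : nat -> nat) : Prop :=
  (rg rBest = 0 /\ forall y, Q y -> ~~ unclaimed h y) \/
  exists z, [/\ unclaimed h z, located z rg 0 1,
    rg rBest = (if touched h (tag z) then 0 else (free h (tag z)).+1)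
  & forall y, Q y -> unclaimed h y -> ~~ touched h (tag y) ->
      ~~ touched h (tag z) && (free h (tag z) <= free h (tag y))].

Lemma best_among_sub (Q Q' : pred (board a)) rg :
  subpred Q' Q -> best_among Q rg -> best_among Q' rg.
Proof.
move=> sQ [[b0 bQ]|[z [uz lz bz bQ]]]; first by left; split=> // y /sQ/bQ.
by right; exists z; split=> // y /sQ/bQ.
Qed.

(** One step of the search for a minimum; the proof follows the branches of [update]. It suffices
    that [Q] and [x] cover [Q']. *)
Lemma updateP (Q Q' : pred (board a)) x rg :
    (forall y, Q' y -> Q y \/ y = x) -> located x rg rI rJ ->
  best_among Q rg -> best_among Q' (sem M (Seq scan update) rg).
Proof.
move=> QQ' lx bQ; rewrite sem_seq; have [Ec Ef Et] := scanP lx.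
have {}lx : located x (sem M scan rg) rI rJ.
  by split; rewrite sem_frame //; case: lx.
have {bQ}: best_among Q (sem M scan rg).
  by rewrite /best_among /located !sem_frame.
move: (sem M scan rg) Ec Ef Et lx => {}rg Ec Ef Et [rgI rgJ] bQ.
(* Shared by all branches that select [x]: it only has to be compared with [Q], since it ties with
   itself. *)
have choose : unclaimed h x -> forall rg', located x rg' 0 1 ->
    rg' rBest = (if touched h (tag x) then 0 else (free h (tag x)).+1) ->
    (forall y, Q y -> unclaimed h y -> ~~ touched h (tag y) ->
      ~~ touched h (tag x) && (free h (tag x) <= free h (tag y))) ->
  best_among Q' rg'.
  move=> ux rg' lx bx xQ; right; exists x; split=> // y /QQ'[/xQ//|->] _ ->.
  by rewrite leqnn.
rewrite /update sem_if value_reg Ec; case: ifPn => [ux|].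
  case: bQ => [[b0 bQ]|[z [uz lz bz bQ]]].
    by left; split=> // y /QQ'[/bQ//|->]; rewrite ux.
  by right; exists z; split=> // y /QQ'[/bQ//|->]; rewrite (negPf ux).
rewrite negbK => ux; rewrite sem_if value_reg Et; case: ifPn => tx.
  rewrite sem_if value_reg; case: ifPn => b0; last first.
    apply: (choose ux) => //; first by rewrite tx; apply/eqP/negbNE.
    move=> y Qy uy ty; case: bQ => [[_ /(_ y Qy)]|[z [_ _ bz /(_ y Qy uy ty)]]].
      by rewrite uy.
    by case/andP=> tz; rewrite bz (negPf tz) in b0.
  case: bQ => [[b0' _]|[z [uz lz bz bQ]]]; first by rewrite b0' in b0.
  by right; exists z; split=> // y /QQ'[/bQ//|->]; rewrite tx.
rewrite sem_if value_reg.
have chosen : located x (sem M choose_box rg) 0 1 /\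
    sem M choose_box rg rBest
      = (if touched h (tag x) then 0 else (free h (tag x)).+1).
  by rewrite (negPf tx) -Ef -[(rg rFree).+1]addn1.
case: bQ => [[b0 bQ]|[z [uz lz bz bQ]]].
  rewrite b0 /=; apply: (choose ux); try by case: chosen.
  by move=> y /bQ /negPf ->.
rewrite bz; case: ifPn => tz in bz *.
  apply: (choose ux); try by case: chosen.
  by move=> y /bQ Qy uy ty; have := Qy uy ty; rewrite tz.
rewrite sem_if; case: ifP => lt.
  apply: (choose ux); try by case: chosen.
  move=> y /bQ Qy uy ty; have /andP[_] := Qy uy ty; rewrite tx /=.
  apply: leq_trans; move: lt; rewrite /value /= bz Ef subn_eq0.
  by rewrite -ltnNge addn1 ltnS => /ltnW.
right; exists z; split=> //; first by rewrite (negPf tz).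
move=> y /QQ'[/bQ//|->] _ _; rewrite tz /=.
move/negbT: lt; rewrite /value /= bz Ef negbK subn_eq0.
by rewrite addn1 ltnS.
Qed.

Lemma greedyP rg : position h -> rg rBest = 0 ->
  exists z, [/\ unclaimed h z, located z (sem M greedy rg) 0 1
    & forall y, unclaimed h y -> ~~ touched h (tag y) ->
        ~~ touched h (tag z) && (free h (tag z) <= free h (tag y))].
Proof.
move=> ph b0.
have Vn rg' : value M rg' boxes = n by rewrite /value /= M_boxes.
have : best_among predT (sem M greedy rg).
  pose Q k (y : board a) := k <= tag y.
  apply: (best_among_sub (Q := Q 0)) => //.
  apply: (for_ind (P := fun k => best_among (Q k))) => //.
    rewrite Vn; left; split=> // y; rewrite /Q leqNgt.
    by rewrite ltn_ord.
  move=> k rg1; rewrite Vn => kn best1; pose i := Ordinal kn.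
  (* The nested loops traverse the board in decreasing lexicographic order; [Q2 j] is the part seen
     when the inner loop has reached [j] in box [k]. *)
  pose Q2 j (y : board a) := (k < tag y) || (tag y == i) && (j <= tagged y).
  apply: (best_among_sub (Q := Q2 0)).
    by move=> y; rewrite /Q /Q2 andbT -(inj_eq val_inj) /=; lia.
  set rg2 := [eta rg1 with _ |-> _].
  have Vi rg' : rg' rI = k -> value M rg' box_size = a i.
    by rewrite /value /= => ->; rewrite -(M_box_size i).
  pose P j rg := rg rI = k /\ best_among (Q2 j) rg.
  apply: (proj2 (for_ind (P := P) _ _ _)) => //.
    split=> //; rewrite (Vi rg2) //.
    have : best_among (Q2 (a i)) rg1.
      apply: best_among_sub best1 => y; rewrite /Q /Q2 => /orP[//|].
      case/andP=> /eqP yi; rewrite leqNgt; case: y yi => i' j /= <-.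
      by rewrite ltn_ord.
    by [].
  move=> j rg3; rewrite (Vi rg2) // => ja [rg3I best3].
  split; first by rewrite sem_frame.
  pose x : board a := Tagged (fun i => 'I_(a i)) (Ordinal ja).
  apply: (updateP (Q := Q2 j.+1) (x := x)) => //.
  move=> y; rewrite /Q2 => /orP[-> |/andP[yi]]; first by left.
  rewrite leq_eqVlt => /orP[jy|->]; last by left; rewrite yi orbT.
  by right; apply/eqP; rewrite eq_board /= yi eq_sym.
case=> [[_ all_claimed]|[z [uz lz _ bz]]]; last first.
  by exists z; split=> // y; apply: bz.
have [y uy] := exists_unclaimed ph.
by have := all_claimed y isT; rewrite uy.
Qed.

End Run.

End Greedy.

(** * The supermartingale *)

Section Potential.
Variables (R : realType) (n : nat) (a : 'I_n -> nat) (p : R).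
Hypothesis p01 : 0 <= p <= 1.
Implicit Types (h : history a) (x : board a).

Let q_ge0 : 0 <= 1 - p. Proof. by rewrite subr_ge0; case/andP: p01. Qed.

(** For an untouched box this is the probability that the next [free h i] coin tosses all favour
    Maker. A full box gets weight 1 even if [p = 1], as [0 ^+ 0 = 1]. *)
Definition weight h (i : 'I_n) : R :=
  if touched h i then 0 else (1 - p) ^+ free h i.

Definition potential h : R := \sum_i weight h i.

Lemma weight_ge0 h i : 0 <= weight h i.
Proof. by rewrite /weight; case: ifP => // _; apply: exprn_ge0. Qed.

Lemma count_rcons (P : pred (move a)) h m :
  count P (rcons h m) = (count P h + P m)%N.
Proof. by rewrite -cats1 count_cat /= addn0. Qed.

Lemma weight_rcons h m i :
  i != tag m.2 -> weight (rcons h m) i = weight h i.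
Proof.
rewrite eq_sym => /negPf mi.
by rewrite /weight /touched /free has_rcons count_rcons /in_box mi andbF addn0.
Qed.

Lemma potential_rcons h m :
  potential (rcons h m)
  = potential h - weight h (tag m.2) + weight (rcons h m) (tag m.2).
Proof.
rewrite /potential (bigD1 (tag m.2)) //=.
rewrite [\sum_i weight h i](bigD1 (tag m.2)) //=.
rewrite (eq_bigr (weight h)); first by ring.
by move=> i; apply: weight_rcons.
Qed.

Lemma size_box (i : 'I_n) (s : seq (board a)) :
  uniq s -> {in s, forall x, tag x = i} -> (size s <= a i)%N.
Proof.
move=> us si; rewrite -[leqRHS]card_ord.
rewrite -(size_codom (fun u : 'I_(a i) => Tagged (fun j => 'I_(a j)) u)).
apply: uniq_leq_size => // -[j u] /si /= ij; case: _ / ij.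
exact: codom_f.
Qed.

(** The elements claimed in the box and [x] itself are distinct, so there are at most [a (tag x)] of
    them. Hence a move at [x] lowers [free] by exactly one, without truncation. *)
Lemma free_gt0 h x :
  uniq [seq m.2 | m <- h] -> unclaimed h x -> (0 < free h (tag x))%N.
Proof.
move=> uh ux; rewrite subn_gt0 -size_filter.
rewrite -(size_map snd) -[X in (X <= _)%N]/(size (x :: _)).
apply: size_box => [|y].
  rewrite /= (subseq_uniq _ uh) ?andbT; last first.
    exact/map_subseq/filter_subseq.
  apply: contra ux => /mapP[m]; rewrite mem_filter => /andP[_ mh] ->.
  exact: map_f.
rewrite inE => /predU1P[->//|/mapP[m]].
by rewrite mem_filter => /andP[/eqP + _] ->.
Qed.

Lemma maker_wins_potential h :
  uniq [seq m.2 | m <- h] -> maker_wins h -> 1 <= potential h.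
Proof.
move=> uh /existsP[i /forallP hi].
suff wi : weight h i = 1.
  rewrite /potential (bigD1 i) //= wi lerDl sumr_ge0 // => j _.
  exact: weight_ge0.
(* A Breaker move in box [i] would claim an element that Maker claims as well, against
   uniqueness. *)
have nt : ~~ touched h i.
  apply/hasP => -[[b [j u]] /= mh /andP[/= b1 /eqP /= ji]].
  case: _ / ji hi => /(_ u); rewrite b1 in mh; case/splitPr: mh uh => s1 s2.
  rewrite map_cat cat_uniq /= => /and3P[_ /norP[u1 _] /andP[u2 _]].
  rewrite mem_cat inE /= => /orP[] /(map_f snd) /=; first by rewrite (negPf u1).
  by rewrite (negPf u2).
(* Maker's moves in box [i] already number [a i], so the truncated subtraction gives 0. *)
have f0 : free h i = 0%N.
  apply/eqP; rewrite subn_eq0 -size_filter.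
  rewrite -[leqLHS]card_ord cardE.
  rewrite -(size_map (fun u => (false, Tagged (fun j => 'I_(a j)) u))).
  apply: uniq_leq_size.
    rewrite map_inj_uniq ?enum_uniq // => u v [] /eqP.
    by rewrite eq_Tagged => /eqP.
  by move=> _ /mapP[u _ ->]; rewrite mem_filter hi /in_box /= eqxx.
by rewrite /weight (negPf nt) f0 expr0.
Qed.

Lemma potential_breaker h x :
  potential (rcons h (true, x)) = potential h - weight h (tag x).
Proof.
rewrite potential_rcons /= {2}/weight /touched has_rcons /in_box /= eqxx.
by rewrite addr0.
Qed.

(** The old weight of the box is [1 - p] times the new one. Keeping the factor [1 - p] avoids a
    division and covers [p = 1]. *)
Lemma potential_maker h x :
    uniq [seq m.2 | m <- h] -> unclaimed h x ->
  (1 - p) * potential (rcons h (false, x))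
  = (1 - p) * potential h + p * weight h (tag x).
Proof.
move=> uh ux; rewrite potential_rcons /=.
have -> : weight h (tag x) = (1 - p) * weight (rcons h (false, x)) (tag x).
  rewrite /weight /touched has_rcons /= /free count_rcons /in_box eqxx.
  case: ifP => _; first by rewrite mulr0.
  have := free_gt0 uh ux; rewrite /free /in_box; set c := count _ _ => c_lt.
  by rewrite -exprS subnDA subn1 prednK.
by ring.
Qed.

End Potential.

(** * The greedy strategy and its running time *)

Definition greedy_regs n (a : 'I_n -> nat) (h : history a) : nat -> nat :=
  sem (nth 0%N (encode h)) greedy (fun=> 0%N).

(** A point mass read off the final registers of the program, so that the strategy agrees with its
    implementation by construction. *)
Definition greedy_strategy (R : realType) n (a : 'I_n -> nat) : strategy a R :=
  fun h x => ((greedy_regs h 0 == tag x :> nat) &&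
              (greedy_regs h 1 == tagged x :> nat))%:R.

Lemma greedy_strategyP (R : realType) n (a : 'I_n -> nat) (h : history a) :
  position h -> exists z,
    [/\ unclaimed h z, forall x, greedy_strategy R h x = (x == z)%:R
      & forall y, unclaimed h y -> ~~ touched h (tag y) ->
          ~~ touched h (tag z) && (free h (tag z) <= free h (tag y))%N].
Proof.
move=> ph.
have [z [uz [z0 z1] bz]] := greedyP erefl ph (erefl : (fun=> 0%N) _ = _).
exists z; split=> // x.
rewrite /greedy_strategy /greedy_regs z0 z1 [x == z]eq_sym eq_board.
by rewrite -(inj_eq val_inj).
Qed.

Lemma is_strategy_greedy (R : realType) n (a : 'I_n -> nat) :
  is_strategy (@greedy_strategy R n a).
Proof.
move=> h ph; have [z [uz sE _]] := greedy_strategyP R ph.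
split=> [x| |x ux]; first by rewrite sE ler0n.
  rewrite (bigD1 z) //= big1 ?addr0 ?sE ?eqxx // => x /negPf.
  by rewrite sE => ->.
by rewrite sE; case: eqP ux => // ->; rewrite uz.
Qed.

Lemma iter_step_halted k s : iter k step ([::], s) = ([::], s).
Proof. by elim: k => //= k ->. Qed.

(** The program tosses no coins, so each element is output for all [2 ^+ T] coin sequences or for
    none. *)
Lemma polynomial_time_greedy (R : realType) :
  polynomial_time (@greedy_strategy R).
Proof.
exists greedy, 100%N, 3%N => n a a0 h ph T.
have N0 : (0 < #|board a|)%N by case/andP: ph => _; apply: leq_trans.
have runT r : run greedy h T r
    = ([::], State (greedy_regs h) (nth 0%N (encode h)) r).
  (* The program may halt before time [T]; a halted configuration then stays fixed. *)
  have [t le E] := runs_greedy (encode_le a0 ph) (fun=> 0%N) r [::].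
  have {}le : (t <= T)%N by apply: leq_trans le (cost_greedy N0).
  by rewrite /run /start -(subnK le) iterD E iter_step_halted.
split=> [r|x]; first by rewrite runT.
rewrite (eq_card (B := [pred r | (greedy_regs h 0 == tag x :> nat) &&
              (greedy_regs h 1 == tagged x :> nat)])); last first.
  by move=> r; rewrite inE /outputs runT.
rewrite /greedy_strategy; case: (_ && _).
  by rewrite card_tuple card_bool natrX divff // expf_neq0 ?pnatr_eq0.
by rewrite card0 mul0r.
Qed.

(** * The winning probability against an arbitrary Maker *)

Section WinProbability.
Variables (R : realType) (n : nat) (a : 'I_n -> nat) (p : R).
Variable maker : strategy a R.
Implicit Types (h : history a) (x : board a).

Local Notation breaker := (@greedy_strategy R n a).

(** Breaker's winning probability with [k] turns left after [h]. The sum may include illegal moves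
    because legal strategies give them probability 0. *)
Fixpoint win_prob (b : strategy a R) (k : nat) (h : history a) : R :=
  if k is k'.+1 then
    \sum_m turn_prob p b maker h m * win_prob b k' (rcons h m)
  else (breaker_wins h)%:R.

(** Distributivity turns the recursion into a sum over complete plays; the prefix [h] is there for
    the induction. *)
Lemma win_probE b k h :
  win_prob b k h =
  \sum_(w : k.-tuple (move a))
     (\prod_(t < k) turn_prob p b maker (h ++ take t w) (tnth w t))
       * (breaker_wins (h ++ w))%:R.
Proof.
elim: k h => [|k IH] h /=.
  rewrite (big_pred1 [tuple]) ?big_ord0 ?cats0 ?mul1r // => w.
  exact/esym/eqP/tuple0.
pose cons_move (mw : move a * k.-tuple (move a)) := [tuple of mw.1 :: mw.2].
rewrite (reindex cons_move) /=; last first.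
  exists (fun w => (thead w, [tuple of behead w])) => [[m w]|w] _ /=.
    by congr (_, _); apply: val_inj.
  by rewrite [RHS]tuple_eta; apply: val_inj.
rewrite -(pair_big xpredT xpredT (fun m (w : k.-tuple _) =>
  (\prod_(t < k.+1) turn_prob p b maker (h ++ take t (m :: w))
                      (tnth [tuple of m :: w] t))
    * (breaker_wins (h ++ m :: w))%:R)) /=.
apply: eq_bigr => m _; rewrite IH mulr_sumr; apply: eq_bigr => w _.
rewrite big_ord_recl take0 cats0 tnth0 mulrA cat_rcons; congr (_ * _ * _).
by apply: eq_bigr => t _; rewrite tnthS /= cat_rcons.
Qed.

Lemma breaker_win_probE b :
  breaker_win_prob p b maker = win_prob b #|board a| [::].
Proof.
rewrite win_probE /breaker_win_prob big_mkcond; apply: eq_bigr => w _ /=.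
by case: breaker_wins; rewrite ?mulr1 ?mulr0.
Qed.

Hypothesis p01 : 0 <= p <= 1.
Hypothesis maker_strategy : is_strategy maker.

(** Induction on the number of turns left: [maker_wins_potential] settles the end of the game, and
    the supermartingale property is the inductive step. *)
Lemma win_prob_ge k h :
    uniq [seq m.2 | m <- h] -> (size h + k)%N = #|board a| ->
  1 - potential p h <= win_prob breaker k h.
Proof.
elim: k h => [|k IH] h uh hk /=.
  rewrite /breaker_wins; case: (boolP (maker_wins h)) => [wh|_] /=.
    by rewrite subr_le0; apply: maker_wins_potential.
  by rewrite gerBl sumr_ge0 // => i _; apply: weight_ge0.
have ph : position h by rewrite /position uh -hk addnS ltnS leq_addr.
have [p0 p1] := andP p01.
have q0 : 0 <= 1 - p by rewrite subr_ge0.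
have [z [uz zE zbest]] := greedy_strategyP R ph.
have [mk0 mk1 mku] := maker_strategy ph.
pose F m := turn_prob p breaker maker h m * (1 - potential p (rcons h m)).
apply: (@le_trans _ _ (\sum_m F m)); last first.
  apply: ler_sum => -[b x] _; rewrite /F.
  (* The induction hypothesis needs distinct claims; a repeated claim has probability 0. *)
  case: (boolP (unclaimed h x)) => ux; last first.
    suff -> : turn_prob p breaker maker h (b, x) = 0 by rewrite !mul0r.
    rewrite /turn_prob /= zE mku //; case: eqP ux => [->|_ _].
      by rewrite uz.
    by rewrite !mulr0; case: b.
  apply: ler_wpM2l.
    by rewrite /turn_prob /= zE; case: b; rewrite mulr_ge0 ?ler0n.
  by apply: IH; rewrite ?map_rcons ?rcons_uniq ?uh ?andbT // size_rcons addSnnS.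
have -> : \sum_m F m = \sum_x F (true, x) + \sum_x F (false, x).
  rewrite (eq_bigr (fun m => F (m.1, m.2))) => [|[]//].
  by rewrite -(pair_big xpredT xpredT (fun b x => F (b, x))) /= big_bool.
have -> : \sum_x F (true, x) = p * (1 - potential p h + weight p h (tag z)).
  rewrite (bigD1 z) //= big1 ?addr0 => [|x /negPf xz].
    rewrite /F /turn_prob /= zE eqxx potential_breaker mulr1; congr (_ * _).
    by ring.
  by rewrite /F /turn_prob /= zE xz mulr0 mul0r.
(* [c] is the contribution of Maker's turn if he plays in a box as heavy as that of [z]. Its loss
   [p * weight p h (tag z)] cancels the gain from Breaker's turn. *)
pose c := (1 - p) * (1 - potential p h) - p * weight p h (tag z).
have : c <= \sum_x F (false, x); last by rewrite /c; lra.
rewrite -[c]mul1r -mk1 mulr_suml; apply: ler_sum => x _.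
case: (boolP (unclaimed h x)) => ux; last first.
  by rewrite /F /turn_prob /= mku // !(mulr0, mul0r).
rewrite /F /turn_prob /= [(1 - p) * _]mulrC -mulrA; apply: ler_wpM2l => //.
rewrite mulrBr potential_maker // mulr1.
(* The greedy choice maximizes the weight, since powers of [1 - p] do not increase with the
   exponent. *)
have : weight p h (tag x) <= weight p h (tag z).
  rewrite {1}/weight; case: ifPn => tx; first exact: weight_ge0.
  have /andP[/negPf tz le] := zbest x ux tx.
  by rewrite /weight tz ler_wiXn2l // gerBl.
move=> /(ler_wpM2l p0); rewrite /c; lra.
Qed.

End WinProbability.

(** From [1 - p <= expR (- p)] each box weighs at most [n^(-(1 + eps))]; summing over [n] boxes
    leaves [n^(-eps)]. *)
Lemma potential_nil_le (R : realType) (eps p : R) (n : nat) (a : 'I_n -> nat) :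
    (0 < n)%N -> 0 < p <= 1 ->
    (forall i : 'I_n, (1 + eps) * ln n%:R / p <= (a i)%:R) ->
  potential p ([::] : history a) <= expR (- (eps * ln n%:R)).
Proof.
move=> n0 /andP[p0 p1] ha.
apply: (@le_trans _ _ (\sum_(i < n) expR (- ((1 + eps) * ln n%:R)))).
  apply: ler_sum => i _; rewrite /weight /free /= subn0.
  apply: (@le_trans _ _ (expR (- p) ^+ a i)).
    by rewrite lerXn2r ?nnegrE ?subr_ge0 ?expR_ge0 // expR_ge1Dx.
  rewrite -expRM_natr ler_expR mulNr lerN2 [p * _]mulrC.
  by rewrite -ler_pdivrMr.
rewrite sumr_const card_ord -[leLHS]mulr_natl -{1}[n%:R]lnK ?posrE ?ltr0n //.
by rewrite -expRD ler_expR; lra.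
Qed.

Theorem theorem1p2 (R : realType) (eps : R) (eps_gt0 : 0 < eps) :
  exists breaker : forall (n : nat) (a : 'I_n -> nat), strategy a R,
    [/\ forall (n : nat) (a : 'I_n -> nat), is_strategy (breaker n a),
        polynomial_time breaker
      & forall delta : R, 0 < delta ->
          \forall n \near \oo,
            forall (p : R) (a : 'I_n -> nat),
              0 < p <= 1 ->
              (forall i : 'I_n, (1 + eps) * ln n%:R / p <= (a i)%:R) ->
              forall maker : strategy a R, is_strategy maker ->
                1 - delta <= breaker_win_prob p (breaker n a) maker].
Proof.
exists (@greedy_strategy R); split.
- exact: is_strategy_greedy.
- exact: polynomial_time_greedy.
move=> delta delta0.
near=> n => p a /[dup] p01 /andP[/ltW p0 p1] ha maker maker_strategy.
(* The threshold is [delta^(-1/eps)], from which on [n^(-eps) <= delta]. It depends on neither [p],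
   [a] nor [maker]. *)
have nK : expR (- ln delta / eps) <= n%:R by near: n; apply: nbhs_infty_ger.
have n0 : (0 < n)%N by near: n; apply: nbhs_infty_gt.
rewrite breaker_win_probE.
have p01' : 0 <= p <= 1 by rewrite p0 p1.
apply: le_trans (win_prob_ge p01' maker_strategy _ _) => //.
rewrite lerD2l lerN2; apply: le_trans (potential_nil_le n0 p01 ha) _.
rewrite -[leRHS]lnK ?posrE // ler_expR lerNl mulrC -ler_pdivrMr //.
by rewrite -ler_expR (lnK (x := n%:R)) // posrE ltr0n.
Unshelve. all: by end_near.
Qed.
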